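(* Assume (A1) (convexity, compactness, bounded subgradients) and (A2) (network assumption), and let the step-size sequence $(c(k))_{k\ge 0}$ satisfy: (i) $c(k)$ is non-negative and non-increasing; (ii) $\sum_{k=1}^\infty c(k)=\infty$ and $\sum_{k=1}^\infty c(k)^2<\infty$. Let $(x_i(k))_{k\ge 0}$, $i=1,\dots,m$, be sequences generated by the subgradient averaging algorithm from arbitrary initial points $x_i(0)\in X_i$. Then there exists a minimizer $x^\star$ of $\sum_{i=1}^m f_i(x)$ over $x\in\bigcap_{i=1}^m X_i$ such that $$\lim_{k\to\infty}\|x_i(k)-x^\star\|_2=0\quad\text{for all } i=1,\dots,m.$$
   Context: Problem: minimise $f(x)=\sum_{i=1}^m f_i(x)$ subject to $x\in\bigcap_{i=1}^m X_i$, with $f_i:\mathbb{R}^n\to\mathbb{R}$ and $X_i\subset\mathbb{R}^n$, $i=1,\dots,m$. (A1): (i) each $f_i$ is convex; (ii) each $X_i$ is compact and convex, and $\bigcap_{i=1}^m X_i$ has non-empty interior; (iii) $L=\max\{\|\xi\|_2:\ \xi\in\partial f(x),\ x\in\bigcup_{i=1}^m X_i\}<\infty$, where $\partial f(x)$ is the convex subdifferential. Network: for each $k\ge 0$, $\mathcal{G}(k)=(\mathcal{N},\mathcal{E}(k))$ is an undirected graph on $\mathcal{N}=\{1,\dots,m\}$ (so $(j,i)\in\mathcal{E}(k)$ iff $(i,j)\in\mathcal{E}(k)$), and $A(k)\in\mathbb{R}^{m\times m}$ is a matrix whose entry in row $j$, column $i$ is denoted $[A(k)]_j^i$; for $j\neq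 i$, $[A(k)]_j^i>0$ if and only if $(j,i)\in\mathcal{E}(k)$. Let $\mathcal{E}_\infty$ be the set of pairs $(j,i)$ such that $(j,i)\in\mathcal{E}(k)$ for infinitely many $k$. (A2): (i) the graph $(\mathcal{N},\mathcal{E}_\infty)$ is strongly connected, and there is a uniform bound on the intercommunication time: there exists an integer $T\ge 1$ such that for every $(j,i)\in\mathcal{E}_\infty$ and every $k\ge 0$, $(j,i)\in\mathcal{E}(k)\cup\mathcal{E}(k+1)\cup\dots\cup\mathcal{E}(k+T-1)$; (ii) there exists $\eta\in(0,1)$ such that for all $k\ge0$ and all $i,j$, $[A(k)]_i^i\ge\eta$, and $[A(k)]_j^i>0$ implies $[A(k)]_j^i\ge\eta$; (iii) each $A(k)$ is doubly stochastic (non-negative entries, all rows and columns summing to one). Subgradient averaging algorithm: given $x_i(0)\in X_i$ for $i=1,\dots,m$, for $k=0,1,2,\dots$ and every $i$: 1. $z_i(k)=\sum_{j=1}^m [A(k)]_j^i\,x_j(k)$; 2. pick any $g_i(z_i(k))\in\partial f_i(z_i(k))$; 3. $d_i(k)=\sum_{j=1}^m [A(k)]_j^i\,g_j(z_j(k))$; 4. $x_i(k+1)=\operatorname{argmin}_{\xi\in X_i}\ d_i(k)^T\xi+\frac{1}{2c(k)}\|z_i(k)-\xi\|_2^2$ (equivalently, the Euclidean projection of $z_i(k)-c(k)d_i(k)$ onto $X_i$). *)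

(* Defs.v *)
From HB Require Import structures.
From mathcomp Require Import all_boot all_order all_algebra.
From mathcomp Require Import all_classical all_reals all_analysis.

Set Implicit Arguments.
Unset Strict Implicit.
Unset Printing Implicit Defensive.

Import Order.TTheory GRing.Theory Num.Theory.
Import numFieldNormedType.Exports.

Local Open Scope classical_set_scope.
Local Open Scope ring_scope.

Section Euclidean.
Variables (R : realType) (n : nat).
Implicit Types u v : 'rV[R]_n.

Definition dot u v : R := \sum_(l < n) u ord0 l * v ord0 l.

(* The library norm [`|v|] on ['rV[R]_n] is the sup norm, whence this one;
   both induce the library topology of ['rV[R]_n]. *)
Definition norm2 v : R := Num.sqrt (dot v v).

Definition subdifferential (f : 'rV[R]_n -> R) (x : 'rV[R]_n) :
    set 'rV[R]_n :=
  [set xi | forall y, f x + dot xi (y - x) <= f y].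

Definition is_argmin (S : set 'rV[R]_n) (phi : 'rV[R]_n -> R)
    (x : 'rV[R]_n) : Prop :=
  S x /\ forall y, S y -> phi x <= phi y.

End Euclidean.

Definition is_max (R : realType) (S : set R) (L : R) : Prop :=
  S L /\ ubound S L.

Section Problem.
Variables (R : realType) (n m : nat).
Variables (f : 'I_m -> 'rV[R]_n -> R) (X : 'I_m -> set 'rV[R]_n).

Definition objective (x : 'rV[R]_n) : R := \sum_(i < m) f i x.

Definition feasible : set 'rV[R]_n := \bigcap_(i in [set: 'I_m]) X i.

Record problem_assumption : Prop := {
  pa_convex_fun : forall i, convex_function setT (f i);
  pa_compact : forall i, compact (X i);
  pa_convex_set : forall i, convex_set (X i);
  pa_interior : (interior feasible) !=set0;
  (* Attainment of the maximum also forces [0 < m]. *)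
  pa_subgradients : exists L : R, is_max
    [set norm2 xi | xi in
       \bigcup_(x in \bigcup_(i in [set: 'I_m]) X i)
         subdifferential objective x] L }.

End Problem.

Section Network.
Variables (R : realType) (m : nat).
(* [E k j i] is the edge (j, i) of the graph at time k; the weight with row j
   and column i is [A k j i].  Self-loops are neither required nor excluded. *)
Variables (E : nat -> rel 'I_m) (A : nat -> 'M[R]_m).

Record network : Prop := {
  net_undirected : forall k, symmetric (E k);
  net_weights : forall k j i, j != i -> (0 < A k j i <-> E k j i) }.

Definition edge_infty : rel 'I_m :=
  fun j i => `[< forall K, exists2 k, (K <= k)%N & E k j i >].

Definition doubly_stochastic (B : 'M[R]_m) : Prop :=
  [/\ forall j i, 0 <= B j i,
      forall j, \sum_(i < m) B j i = 1
    & forall i, \sum_(j < m) B j i = 1].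

Record network_assumption : Prop := {
  na_strongly_connected : forall j i, connect edge_infty j i;
  na_intercommunication : exists2 T : nat, (1 <= T)%N &
    forall j i, edge_infty j i ->
      forall k, exists2 l, (l < T)%N & E (k + l) j i;
  na_weights : exists2 eta : R, 0 < eta < 1 &
    forall k, (forall i, eta <= A k i i) /\
              (forall j i, 0 < A k j i -> eta <= A k j i);
  na_stochastic : forall k, doubly_stochastic (A k) }.

End Network.

Record step_size (R : realType) (c : nat -> R) : Prop := {
  ss_ge0 : forall k, 0 <= c k;
  ss_nonincreasing : forall k l, (k <= l)%N -> c l <= c k;
  ss_sum : (\sum_(1 <= k <oo) (c k)%:E = +oo)%E;
  ss_sum_sqr : (\sum_(1 <= k <oo) (c k ^+ 2)%:E < +oo)%E }.

(* [g i k] is the subgradient picked by agent i at [z i k].  The inverse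
   [(2 * c k)^-1] is genuine whenever [step_size c], which forces [0 < c k]. *)
Record subgradient_averaging (R : realType) (n m : nat)
    (f : 'I_m -> 'rV[R]_n -> R) (X : 'I_m -> set 'rV[R]_n)
    (A : nat -> 'M[R]_m) (c : nat -> R)
    (x z g d : 'I_m -> nat -> 'rV[R]_n) : Prop := {
  sa_init : forall i, X i (x i 0%N);
  sa_average : forall i k, z i k = \sum_(j < m) A k j i *: x j k;
  sa_subgradient : forall i k, subdifferential (f i) (z i k) (g i k);
  sa_direction : forall i k, d i k = \sum_(j < m) A k j i *: g j k;
  sa_update : forall i k,
    is_argmin (X i)
      (fun xi => dot (d i k) xi + (2 * c k)^-1 * norm2 (z i k - xi) ^+ 2)
      (x i k.+1) }.

(* Main.v *)
(* With e_i(k) = x_i(k+1) - z_i(k), the variational inequality of the prox step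
   and the Jensen inequality for doubly stochastic weights give, for feasible v
   and y(k) = x_{i0}(k) the iterate of one fixed agent,
     S_v(k+1) + |e(k)|^2
       <= S_v(k) + 2 c(k) (f(v) - f(y(k)) + C (D(k) + |e(k)|)),
   where S_v(k) = sum_i |x_i(k) - v|^2 and D(k) is the disagreement. Connectivity
   makes D contract over windows of fixed length up to the errors |e|; as c is
   non-increasing, sum c D is bounded by a constant plus a multiple of
   sum c |e|, which AM-GM absorbs into sum |e|^2 and sum c^2. An interior
   feasible point yields f(y(k)) >= min f - C' D(k), so the nonnegative quantity
   phi = f(y) - min f + C' D satisfies sum c phi < oo. As sum c = oo, phi and D are
   simultaneously small infinitely often; a limit point p of y along those times
   is a minimiser, and the summable-error descent of S_p forces S_p -> 0. *)
Require Import Defs.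
From mathcomp Require Import all_boot all_order all_algebra.
From mathcomp Require Import all_classical all_reals all_analysis.
From mathcomp Require Import zify ring lra.

Import Order.TTheory GRing.Theory Num.Theory.
Import numFieldNormedType.Exports.

Local Open Scope classical_set_scope.
Local Open Scope ring_scope.

(** * Convex functions on row vectors *)

Section Convex.
Context {R : realType} {n : nat}.
Implicit Types (u v w x y : 'rV[R]_n) (t r : R).

Lemma convex_setP {S : set 'rV[R]_n} (cS : convex_set S) x y {t} :
  S x -> S y -> 0 <= t -> t <= 1 -> S (t *: x + (1 - t) *: y).
Proof.
move=> Sx Sy t0 t1.
by have := cS x y (Itv01 t0 t1) (mem_set Sx) (mem_set Sy); rewrite inE.
Qed.

Lemma convex_functionP {f : 'rV[R]_n -> R} (cf : convex_function setT f)
    x y {t} : 0 <= t -> t <= 1 ->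
  f (t *: x + (1 - t) *: y) <= t * f x + (1 - t) * f y.
Proof.
move=> t0 t1.
by have := cf (Itv01 t0 t1) x y (in_setT _) (in_setT _).
Qed.

Lemma norm_row_le u t : 0 <= t -> (forall l, `|u ord0 l| <= t) -> `|u| <= t.
Proof.
move=> t0 ut; rewrite [leLHS]/Num.Def.normr /= mx_normrE.
by apply/bigmax_leP; split => // -[i l] _ /=; rewrite ord1.
Qed.

Lemma norm_entry_le u l : `|u ord0 l| <= `|u|.
Proof.
rewrite [leRHS]/Num.Def.normr /= mx_normrE; apply/bigmax_geP; right.
by exists (ord0, l).
Qed.

Lemma convex_bounded_above_line {f : 'rV[R]_n -> R} u r :
  convex_function setT f -> 0 < r ->
  exists M, forall t, `|t| <= r -> f (t *: u) <= M.
Proof.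
move=> cf r0; exists (`|f (r *: u)| + `|f (- r *: u)|) => t.
rewrite ler_norml => /andP[tr1 tr2].
pose s := (t + r) / (2 * r).
have s0 : 0 <= s by rewrite /s divr_ge0//; lra.
have s1 : s <= 1 by rewrite /s ler_pdivrMr; lra.
have -> : t *: u = s *: (r *: u) + (1 - s) *: (- r *: u).
  by rewrite !scalerA -scalerDl; congr (_ *: _); rewrite /s; field; lra.
apply: (le_trans (convex_functionP cf _ _ s0 s1)).
have h1 := ler_norm (f (r *: u)); have h2 := ler_norm (f (- r *: u)).
have h3 := normr_ge0 (f (r *: u)); have h4 := normr_ge0 (f (- r *: u)).
apply: lerD.
  by apply: (le_trans (ler_wpM2l s0 h1)); rewrite ler_piMl.
by apply: (le_trans (ler_wpM2l _ h2)); rewrite ?ler_piMl//; lra.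
Qed.

(** Induction over the list of coordinates: a combination is the midpoint of twice its first term
    and twice the remaining terms. This is why the radius must be general in [H]: it doubles at each
    step. *)
Lemma convex_bounded_above {f : 'rV[R]_n -> R} r : convex_function setT f ->
  exists M, forall x, `|x| <= r -> f x <= M.
Proof.
move=> cf.
suff H (s : seq 'I_n) r' : 0 < r' -> exists M, forall a : 'I_n -> R,
    (forall l, `|a l| <= r') -> f (\sum_(l <- s) a l *: 'e_l) <= M.
  have r1 : 0 < `|r| + 1 by have := normr_ge0 r; lra.
  have [M HM] := H (index_enum 'I_n) _ r1; exists M => x xr.
  rewrite (row_sum_delta x); apply: HM => l.
  by have := norm_entry_le x l; have := ler_norm r; lra.
elim: s r' => [|l0 s IH] r' r'0; first by exists (f 0) => a _; rewrite big_nil.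
have r2 : 0 < 2 * r' by lra.
have [M1 HM1] := IH _ r2.
have [M2 HM2] := convex_bounded_above_line 'e_l0 _ cf r2.
exists (2^-1 * M2 + (1 - 2^-1) * M1) => a ar; rewrite big_cons.
have a2 l : `|2 * a l| <= 2 * r' by rewrite normrM gtr0_norm// ler_pM2l.
have -> : a l0 *: 'e_l0 + \sum_(l <- s) a l *: 'e_l =
    2^-1 *: ((2 * a l0) *: 'e_l0) + (1 - 2^-1) *: \sum_(l <- s) (2 * a l) *: 'e_l :> 'rV[R]_n.
  rewrite scaler_sumr scalerA; congr (_ + _); last apply: eq_bigr => l _.
    by congr (_ *: _); field.
  by rewrite scalerA; congr (_ *: _); field.
apply: (le_trans (convex_functionP cf _ _ _ _)); [lra|lra|].
have := HM2 _ (a2 l0); have := HM1 _ a2; lra.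
Qed.

(** The origin is the midpoint of [x] and [- x], so an upper bound at [- x] turns into a lower bound
    at [x]. *)
Lemma convex_bounded {f : 'rV[R]_n -> R} r : convex_function setT f ->
  exists M, forall x, `|x| <= r -> `|f x| <= M.
Proof.
move=> cf; have [M HM] := convex_bounded_above r cf.
exists (`|M| + 2 * `|f 0|) => x xr.
have h1 := HM _ xr; have h2 : f (- x) <= M by apply: HM; rewrite normrN.
have /(convex_functionP cf x (- x)) : (0 : R) <= 2^-1 by lra.
rewrite (_ : 2^-1 *: x + (1 - 2^-1) *: - x = 0); last first.
  by rewrite scalerN -scalerBl (_ : _ - _ = 0) ?scale0r//; field.
move=> /(_ ltac:(lra)) h3.
have := ler_norm M; have := ler_norm (- f 0); rewrite normrN.
have := normr_ge0 M; have := normr_ge0 (f 0).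
by rewrite ler_norml; lra.
Qed.

(** Prolong the segment from [y] to [x] by unit length, up to [w]. Then [x] is a convex combination
    of [w] and [y] with weight at most [|x - y|] on [w], and [f] is bounded on the ball of radius
    [r + 1], which contains [w]. *)
Lemma convex_lipschitz {f : 'rV[R]_n -> R} r : convex_function setT f ->
  exists2 L, 0 <= L & forall x y, `|x| <= r -> `|y| <= r ->
    f x - f y <= L * `|x - y|.
Proof.
move=> cf; have [M HM] := convex_bounded (r + 1) cf.
exists (2 * `|M|); first by rewrite mulr_ge0.
move=> x y xr yr; have [->|xy] := eqVneq x y.
  by rewrite !subrr normr0 mulr0.
have dgt0 : 0 < `|x - y| by rewrite normr_gt0 subr_eq0.
set d := `|x - y| in dgt0 *; pose w := x + d^-1 *: (x - y).
have dn0 : d != 0 by rewrite gt_eqF.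
have wr : `|w| <= r + 1.
  apply: (le_trans (ler_normD _ _)); apply: lerD => //.
  by rewrite normrZ ger0_norm ?invr_ge0 ?(ltW dgt0)// mulVf.
have d1 : 0 < 1 + d by lra.
pose s := d / (1 + d).
have sd : s * (1 + d) = d by rewrite /s divfK// gt_eqF.
have s0 : 0 <= s by rewrite divr_ge0// ltW.
have s1 : s <= 1 by rewrite ler_pdivrMr//; lra.
have sld : s <= d by rewrite ler_pdivrMr//; nra.
have xE : x = s *: w + (1 - s) *: y.
  apply/rowP => l; rewrite !mxE /s; field.
  by rewrite dn0 gt_eqF.
have := convex_functionP cf w y s0 s1; rewrite -xE => fx.
have fw := HM _ wr; have fy : `|f y| <= M by apply: HM; lra.
have := ler_norm (f w); have := ler_norm (- f y); rewrite normrN => h1 h2.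
have h3 := ler_norm M; have M0 := normr_ge0 M.
have : s * (f w - f y) <= d * (2 * `|M|).
  apply: (@le_trans _ _ (s * (2 * `|M|))); first by apply: ler_wpM2l => //; lra.
  by apply: ler_wpM2r => //; lra.
lra.
Qed.

End Convex.

(** * Scalar product and projections *)

Section Dot.
Context {R : realType} {n : nat}.
Implicit Types (u v w x y z d : 'rV[R]_n) (t r : R).

Lemma dotC u v : dot u v = dot v u.
Proof. by apply: eq_bigr => l _; rewrite mulrC. Qed.

Lemma dotDr u v w : dot u (v + w) = dot u v + dot u w.
Proof. by rewrite -big_split /=; apply: eq_bigr => l _; rewrite mxE mulrDr. Qed.

Lemma dotZr t u v : dot u (t *: v) = t * dot u v.
Proof. by rewrite mulr_sumr; apply: eq_bigr => l _; rewrite mxE mulrCA. Qed.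

Lemma dotNr u v : dot u (- v) = - dot u v.
Proof. by rewrite -scaleN1r dotZr mulN1r. Qed.

Lemma dotBr u v w : dot u (v - w) = dot u v - dot u w.
Proof. by rewrite dotDr dotNr. Qed.

Lemma dotZl t u v : dot (t *: u) v = t * dot u v.
Proof. by rewrite dotC dotZr dotC. Qed.

Lemma dotBl u v w : dot (u - v) w = dot u w - dot v w.
Proof. by rewrite dotC dotBr !(dotC w). Qed.

Lemma dot_suml (I : finType) (F : I -> 'rV[R]_n) v :
  dot (\sum_i F i) v = \sum_i dot (F i) v.
Proof.
rewrite /dot exchange_big /=; apply: eq_bigr => l _.
by rewrite summxE mulr_suml.
Qed.

Lemma dot_ge0 u : 0 <= dot u u.
Proof. by apply: sumr_ge0 => l _; rewrite -expr2 sqr_ge0. Qed.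

Lemma norm2_ge0 u : 0 <= norm2 u.
Proof. exact: sqrtr_ge0. Qed.

Lemma norm2_sqr u : norm2 u ^+ 2 = dot u u.
Proof. by rewrite sqr_sqrtr// dot_ge0. Qed.

Lemma sqr_norm_le_dot u : `|u| ^+ 2 <= dot u u.
Proof.
rewrite -norm2_sqr ler_sqr ?nnegrE ?norm2_ge0//.
apply: norm_row_le; first exact: norm2_ge0.
move=> l.
rewrite -sqrtr_sqr ler_wsqrtr// /dot (bigD1 l)//= -expr2 lerDl.
by apply: sumr_ge0 => k _; rewrite -expr2 sqr_ge0.
Qed.

Lemma dot_norm_le u v : `|dot u v| <= n%:R * (`|u| * `|v|).
Proof.
apply: (le_trans (ler_norm_sum _ _ _)).
apply: (@le_trans _ _ (\sum_(l < n) `|u| * `|v|)).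
  by apply: ler_sum => l _; rewrite normrM ler_pM// norm_entry_le.
by rewrite sumr_const card_ord mulr_natl.
Qed.

(** Jensen for the squared Euclidean norm: the difference of the two sides is the weighted variance
    of [F] around its mean [w]. *)
Lemma dot_convex_comb (I : finType) (a : I -> R) (F : I -> 'rV[R]_n) :
  (forall i, 0 <= a i) -> \sum_i a i = 1 ->
  dot (\sum_i a i *: F i) (\sum_i a i *: F i) <= \sum_i a i * dot (F i) (F i).
Proof.
move=> a0 a1; set w := \sum_i a i *: F i.
have : 0 <= \sum_i a i * dot (F i - w) (F i - w).
  by apply: sumr_ge0 => i _; rewrite mulr_ge0// dot_ge0.
rewrite (_ : \sum_i _ = \sum_i a i * dot (F i) (F i) - dot w w) ?subr_ge0//.
transitivity (\sum_i a i * dot (F i) (F i) - 2 * \sum_i a i * dot (F i) w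
   + (\sum_i a i) * dot w w).
  rewrite mulr_sumr mulr_suml -sumrB -big_split /=; apply: eq_bigr => i _.
  by rewrite !(dotBl, dotBr) (dotC w (F i)); ring.
rewrite (_ : \sum_i a i * dot (F i) w = dot w w); first by rewrite a1; ring.
by rewrite {2}/w dot_suml; apply: eq_bigr => i _; rewrite dotZl.
Qed.

Lemma ler0_quadratic (a b : R) : 0 <= b ->
  (forall t, 0 <= t -> t <= 1 -> 0 <= t * a + t ^+ 2 * b) -> 0 <= a.
Proof.
move=> b0 H; rewrite leNgt; apply/negP => a0.
(* For negative [a] this weight lies in (0, 1] and makes [a + t * b] equal to [- a ^+ 2 / (b - a)],
   which is negative. *)
pose t := - a / (b - a).
have ba : 0 < b - a by lra.
have tb : t * (b - a) = - a by rewrite /t divfK// gt_eqF.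
have t0 : 0 < t by rewrite divr_gt0//; lra.
have t1 : t <= 1 by rewrite ler_pdivrMr//; lra.
have := H _ (ltW t0) t1; rewrite (_ : _ + _ = t * (a + t * b)); last by ring.
rewrite pmulr_rge0//; nra.
Qed.

(** Comparing [p] with the points [p + s *: (x - p)] of [S] and keeping the first-order term in [s]
    gives the variational inequality; expanding the squares around [p] does the rest. *)
Lemma prox_argmin (S : set 'rV[R]_n) d z p t x : convex_set S -> 0 < t ->
  is_argmin S (fun y => dot d y + (2 * t)^-1 * norm2 (z - y) ^+ 2) p -> S x ->
  dot (p - x) (p - x) + dot (p - z) (p - z)
    <= dot (z - x) (z - x) + 2 * t * dot d (x - p).
Proof.
move=> cS t0 [Sp pmin] Sx.
have t2 : 0 < 2 * t by lra.
suff : 0 <= 2 * t * dot d (x - p) + 2 * dot (p - z) (x - p).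
  by rewrite !(dotBl, dotBr) !(dotC x) !(dotC p z); lra.
apply: (@ler0_quadratic _ (dot (x - p) (x - p))); first exact: dot_ge0.
move=> s s0 s1; have := pmin _ (convex_setP cS _ _ Sx Sp s0 s1).
rewrite (_ : s *: x + (1 - s) *: p = p + s *: (x - p)); last first.
  by apply/rowP => l; rewrite !mxE; ring.
rewrite !norm2_sqr -(ler_pM2l t2) !mulrDr !(mulrA (2 * t) (2 * t)^-1).
rewrite divff ?gt_eqF// !mul1r.
rewrite opprD addrA -(opprB z p) (dotDr d) (dotZr _ d).
move: (z - p) (x - p) => a b.
rewrite (dotC (- a)) dotNr !(dotBl, dotBr) !(dotZl, dotZr) (dotC b a); lra.
Qed.

(** Test the subgradient in the direction of a signed unit vector, which picks out the absolute
    value of one entry. The test point leaves the ball of radius [r] by at most 1, whence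
    [r + 1]. *)
Lemma subgradient_norm_le {f : 'rV[R]_n -> R} L r x u : 0 <= L ->
  (forall x y, `|x| <= r + 1 -> `|y| <= r + 1 -> f x - f y <= L * `|x - y|) ->
  `|x| <= r -> subdifferential f x u -> `|u| <= L.
Proof.
move=> L0 lipf xr subu; apply: norm_row_le => // l.
pose w : 'rV[R]_n := Num.sg (u ord0 l) *: 'e_l.
have w1 : `|w| <= 1.
  rewrite normrZ -[leRHS]mulr1 ler_pM//; first by rewrite normr_sg lern1 leq_b1.
  apply: norm_row_le => // k; rewrite mxE eqxx /=.
  by case: (_ == _); rewrite ?normr1 ?normr0.
have := subu (x + w); rewrite addrAC subrr add0r dotZr.
rewrite (_ : dot u 'e_l = u ord0 l); last first.
  rewrite /dot (bigD1 l)//= mxE !eqxx mulr1 big1 ?addr0// => k /negPf kl.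
  by rewrite mxE kl andbF mulr0.
rewrite -normrEsg => H1.
have := lipf (x + w) x; rewrite addrAC subrr add0r => /(_ _ _)/wrap[].
  by apply: (le_trans (ler_normD _ _)); lra.
  by lra.
by have : L * `|w| <= L by [rewrite ler_piMr]; lra.
Qed.

End Dot.

(* Pull [y] towards an interior point [x0] by the proportion [e / (e + s)],
   where the ball of radius [s] around [x0] is feasible. *)
Lemma linear_regularity {R : realType} {n m : nat} (X : 'I_m -> set 'rV[R]_n)
    (r : R) :
  (forall i, convex_set (X i)) -> interior (feasible X) !=set0 ->
  exists2 K, 0 <= K & forall y e, `|y| <= r -> 0 <= e ->
    (forall i, exists2 x, X i x & `|y - x| <= e) ->
    exists2 v, feasible X v & `|y - v| <= K * e.
Proof.
move=> cX [x0 /nbhs_ballP[s0 s00 ballX]].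
have s0_gt0 : 0 < s0 := s00.
pose s := s0 / 2; have sgt0 : 0 < s by rewrite divr_gt0.
have K0 : 0 <= (`|r| + `|x0|) / s by rewrite divr_ge0 ?addr_ge0// ltW.
exists ((`|r| + `|x0|) / s) => // y e yr.
rewrite le_eqVlt => /orP[/eqP <- near|e0 near].
  exists y; last by rewrite subrr normr0 mulr0.
  by move=> i _; have [x Xx] := near i; rewrite normr_le0 subr_eq0 => /eqP ->.
pose t := e / (e + s).
have es0 : 0 < e + s by lra.
have t0 : 0 <= t by rewrite divr_ge0// ltW.
have t1 : t <= 1 by rewrite ler_pdivrMr//; lra.
exists (t *: x0 + (1 - t) *: y).
  move=> i _; have [x Xx yx] := near i.
  (* The shift has norm at most [s], so [w] stays in the feasible ball. The scale [s / e] makes the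
     pulled point the combination of [w] and [x] with the same weight [t], hence a point of
     [X i]. *)
  pose w := x0 + (s / e) *: (y - x).
  have Xw : X i w.
    apply: ballX => //; rewrite -ball_normE /ball_ /= /w opprD addNKr normrN.
    rewrite normrZ ger0_norm; last by rewrite divr_ge0// ltW.
    apply: (@le_lt_trans _ _ (s / e * e)).
      by apply: ler_wpM2l => //; rewrite divr_ge0// ltW.
    by rewrite divfK ?gt_eqF// /s; lra.
  rewrite (_ : _ + _ = t *: w + (1 - t) *: x); first exact: convex_setP.
  by apply/rowP => l; rewrite !mxE /t; field; rewrite !gt_eqF.
rewrite (_ : _ - _ = t *: (y - x0)); last by apply/rowP => l; rewrite !mxE; ring.
rewrite normrZ ger0_norm// [leRHS](_ : _ = e / s * (`|r| + `|x0|)); last by ring.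
apply: ler_pM => //; first by rewrite ler_pM2l// lef_pV2 ?posrE//; lra.
apply: (le_trans (ler_normB _ _)); apply: lerD => //.
by apply: (le_trans yr); exact: ler_norm.
Qed.

(** * Mixing of the network *)

Section Mixing.
Context {R : realType} {m : nat}.
Variables (E : nat -> rel 'I_m) (A : nat -> 'M[R]_m).
Hypotheses (netEA : network E A) (naEA : network_assumption E A).

Let a_ge0 k j i : 0 <= A k j i.
Proof. by have [] := na_stochastic naEA k. Qed.

Lemma flow_ge0 k0 (u : nat -> 'I_m -> R) : (forall i, 0 <= u 0%N i) ->
  (forall s i, \sum_j A (k0 + s) j i * u s j <= u s.+1 i) ->
  forall s i, 0 <= u s i.
Proof.
move=> u0 uS; elim=> [|s IH] i //; apply: le_trans (uS s i).
by apply: sumr_ge0 => j _; rewrite mulr_ge0.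
Qed.

(* Working with supersolutions [u] of the averaging dynamics avoids transition
   matrices and lets [u] absorb the perturbations later on. *)
Lemma flow_lower_bound : exists t B, [/\ (0 : R) < t, t <= 1 &
  forall k0 (u : nat -> 'I_m -> R), (forall i, 0 <= u 0%N i) ->
  (forall s i, \sum_j A (k0 + s) j i * u s j <= u s.+1 i) ->
  forall j i, t * u 0%N j <= u B i].
Proof.
have [eta /andP[eta0 eta1] Heta] := na_weights naEA.
have [T T1 HT] := na_intercommunication naEA.
pose flow k0 (u : nat -> 'I_m -> R) := (forall s i, 0 <= u s i) /\
  (forall s i, \sum_j A (k0 + s) j i * u s j <= u s.+1 i).
have step k0 u s j i : flow k0 u -> eta <= A (k0 + s) j i ->
    eta * u s j <= u s.+1 i.
  move=> [u0 uS] ej; apply: le_trans (uS s i).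
  rewrite (bigD1 j)//=; apply: (@le_trans _ _ (A (k0 + s) j i * u s j)).
    by rewrite ler_wpM2r.
  by rewrite lerDl; apply: sumr_ge0 => l _; rewrite mulr_ge0.
have stay k0 u s d i : flow k0 u -> eta ^+ d * u s i <= u (s + d)%N i.
  move=> fu; elim: d => [|d IH]; first by rewrite expr0 mul1r addn0.
  rewrite addnS exprS -mulrA; apply: le_trans (step _ _ _ i _ fu _).
    by rewrite ler_pM2l.
  by have [] := Heta (k0 + (s + d))%N.
have edge k0 u s j i : flow k0 u -> edge_infty E j i ->
    eta ^+ T * u s j <= u (s + T)%N i.
  move=> fu eji; have [l lT El] := HT _ _ eji (k0 + s)%N.
  have ej : eta <= A (k0 + (s + l)) j i.
    have [Hd Ho] := Heta (k0 + (s + l))%N.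
    have [->|ji] := eqVneq j i; first exact: Hd.
    by apply: Ho; apply/(net_weights netEA) => //; rewrite addnA.
  (* Within the window: wait at [j] for [l] steps, cross the edge, then wait at [i]. Each step costs
     at most a factor [eta]. *)
  have -> : T = (l + 1 + (T - l.+1))%N by rewrite addn1 subnKC.
  rewrite !exprD expr1 (addnA s) (addnA s l 1%N) addn1.
  apply: le_trans (stay _ _ _ _ _ fu).
  rewrite [leLHS](_ : _ = eta ^+ (T - l.+1) * (eta * (eta ^+ l * u s j)));
    last by ring.
  rewrite ler_pM2l ?exprn_gt0//; apply: le_trans (step _ _ _ _ _ fu ej).
  by rewrite ler_pM2l//; exact: (stay k0).
have pathT k0 u : flow k0 u -> forall p s j, path (edge_infty E) j p ->
    eta ^+ (size p * T) * u s j <= u (s + size p * T)%N (last j p).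
  move=> fu; elim=> [|i p IH] s j /=; first by rewrite mul0n expr0 mul1r addn0.
  move=> /andP[eji pp]; rewrite mulSn exprD addnA.
  apply: le_trans (IH _ _ pp); rewrite (mulrC (eta ^+ T)) -mulrA.
  by rewrite ler_pM2l ?exprn_gt0//; exact: (edge k0).
(* A duplicate-free path has fewer than [m] edges, each crossed within [T] steps; the time left over
   is spent waiting at [i]. *)
pose B := (m * T)%N; exists (eta ^+ B), B; split => //.
- by rewrite exprn_gt0.
- by rewrite exprn_ile1// ltW.
move=> k0 u u0 uS j i.
have fu : flow k0 u by split => //; exact: (flow_ge0 k0).
have /connectP[p0 /shortenP[p pp up _] ->] := na_strongly_connected naEA j i.
have pB : (size p * T <= B)%N.
  rewrite /B leq_mul2r; apply/orP; right.
  by have := max_card [in j :: p]; rewrite (card_uniqP up) card_ord => /ltnW.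
rewrite -(subnKC pB) exprD -mulrA mulrCA.
apply: le_trans (stay _ _ _ _ _ fu).
by rewrite ler_pM2l ?exprn_gt0//; exact: (pathT k0).
Qed.

(** Supplies the supersolutions for [flow_lower_bound]: the deficit below [M], enlarged by the
    errors accumulated so far. Unit column sums let the constant pass through the average. *)
Lemma perturbed_le (a e : nat -> 'I_m -> R) (eps : nat -> R) k0 M :
  (forall k i, a k.+1 i = \sum_j A k j i * a k j + e k i) ->
  (forall k i, `|e k i| <= eps k) -> (forall i, a k0 i <= M) ->
  forall s i, \sum_j A (k0 + s) j i
      * (M + \sum_(r < s) eps (k0 + r)%N - a (k0 + s)%N j)
    <= M + \sum_(r < s.+1) eps (k0 + r)%N - a (k0 + s).+1 i.
Proof.
move=> aS eeps aM s i; rewrite aS big_ord_recr /=.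
set q := \sum_(r < s) _.
rewrite (_ : \sum_j _ = M + q - \sum_j A (k0 + s)%N j i * a (k0 + s)%N j).
  by have := eeps (k0 + s)%N i; rewrite ler_norml => /andP[]; lra.
have [_ _ col1] := na_stochastic naEA (k0 + s)%N.
rewrite -[M + q in RHS]mul1r -(col1 i) mulr_suml -sumrB.
by apply: eq_bigr => j _; rewrite mulrBr.
Qed.

(** The deficit [u] below the maximum equals the full spread at the lowest agent [jm], so after [B]
    steps every agent is below the old maximum by a fraction [t] of the spread. For the minimum,
    nonnegativity of the excess [v] suffices. Each side carries one error sum, whence the factor
    2. *)
Lemma diameter_contraction : exists t B, [/\ (0 : R) < t, t <= 1 &
  forall (a e : nat -> 'I_m -> R) (eps : nat -> R),
  (forall k i, a k.+1 i = \sum_j A k j i * a k j + e k i) ->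
  (forall k i, `|e k i| <= eps k) ->
  forall k (D : R), (forall i j, a k i - a k j <= D) ->
  forall i j, a (k + B)%N i - a (k + B)%N j
    <= (1 - t) * D + 2 * \sum_(r < B) eps (k + r)%N].
Proof.
have [t [B [t0 t1 H]]] := flow_lower_bound.
exists t, B; split => // a e eps aS eeps k D aD i j.
pose jM := [arg max_(l > i) a k l]%O; pose jm := [arg min_(l < i) a k l]%O.
have aM l : a k l <= a k jM by rewrite /jM; case: arg_maxP => // l' _; apply.
have am l : a k jm <= a k l by rewrite /jm; case: arg_minP => // l' _; apply.
pose u s l := a k jM + \sum_(r < s) eps (k + r)%N - a (k + s)%N l.
pose v s l := - a k jm + \sum_(r < s) eps (k + r)%N - - a (k + s)%N l.
have u0 l : 0 <= u 0%N l by rewrite /u big_ord0 addn0 addr0 subr_ge0.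
have uS s l : \sum_j A (k + s) j l * u s j <= u s.+1 l.
  by rewrite /u addnS; exact: perturbed_le.
have v0 l : 0 <= v 0%N l.
  by rewrite /v big_ord0 addn0 addr0 subr_ge0 lerN2.
have vS s l : \sum_j A (k + s) j l * v s j <= v s.+1 l.
  rewrite /v addnS; apply: (@perturbed_le (fun k i => - a k i)
     (fun k i => - e k i)) => [k' i'|k' i'|i'].
  - rewrite aS opprD -sumrN; congr (_ + _); apply: eq_bigr => l' _.
    by rewrite mulrN.
  - by rewrite normrN.
  - by rewrite lerN2.
have := H k u u0 uS jm i.
have := flow_ge0 k v v0 vS B j; rewrite /u /v big_ord0 addn0 addr0.
have : t * (a k jM - a k jm) + (1 - t) * (a k jM - a k jm) = a k jM - a k jm.
  by ring.
have : (1 - t) * (a k jM - a k jm) <= (1 - t) * D.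
  by apply: ler_wpM2l; [lra|exact: aD].
lra.
Qed.

End Mixing.

(** * Real sequences and step sizes *)

Section RealSequences.
Context {R : realType}.
Implicit Types (c h w S D eps phi : nat -> R).

Lemma psum_ge0 h N : (forall k, 0 <= h k) -> 0 <= \sum_(k < N) h k.
Proof. by move=> h0; exact: sumr_ge0. Qed.

Lemma psum_le h N N' : (forall k, 0 <= h k) -> (N <= N')%N ->
  \sum_(k < N) h k <= \sum_(k < N') h k.
Proof.
move=> h0 /subnKC <-; rewrite big_split_ord /= lerDl.
exact: (@psum_ge0 (fun k => h (N + k)%N)).
Qed.

Lemma psum_tail h M e : (forall k, 0 <= h k) ->
  (forall N, \sum_(k < N) h k <= M) -> 0 < e ->
  exists K, forall N, \sum_(k < N) h k <= \sum_(k < K) h k + e.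
Proof.
move=> h0 hM e0; pose P := range (fun N => \sum_(k < N) h k).
have supP : has_sup P.
  by split; [exists (\sum_(k < 0) h k), 0%N|exists M => _ [N _ <-]; exact: hM].
have [_ [K _ <-] HK] := sup_adherent e0 supP.
exists K => N; have : \sum_(k < N) h k <= sup P.
  by apply: ub_le_sup; [exact: supP.2|exists N].
lra.
Qed.

(** Start from a time at which [S] is below [e / 2] and after which the increments [h] add up to at
    most [e / 2]. *)
Lemma quasi_fejer_cvg0 S h M : (forall k, 0 <= h k) ->
  (forall N, \sum_(k < N) h k <= M) -> (forall k, S k.+1 <= S k + h k) ->
  (forall e K, 0 < e -> exists2 k, (K <= k)%N & S k <= e) ->
  forall e, 0 < e -> exists K, forall k, (K <= k)%N -> S k <= e.
Proof.
move=> h0 hM SS liminfS e e0.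
have e20 : 0 < e / 2 by rewrite divr_gt0.
have [K HK] := psum_tail h M (e / 2) h0 hM e20.
have [k1 Kk1 Sk1] := liminfS (e / 2) K e20.
exists k1 => k /subnKC <-; set d := (k - k1)%N.
suff : S (k1 + d)%N <= S k1 + (\sum_(l < k1 + d) h l - \sum_(l < k1) h l).
  have := HK (k1 + d)%N; have := psum_le h _ _ h0 Kk1; lra.
elim: d => [|d IH]; first by rewrite addn0; lra.
by rewrite addnS big_ord_recr /=; have := SS (k1 + d)%N; lra.
Qed.

Section StepSize.
Variable c : nat -> R.
Hypothesis step_c : step_size c.

Let c_ge0 : forall k, 0 <= c k := ss_ge0 step_c.

Lemma step_psum_unbounded M : ~ forall N, \sum_(k < N) c k <= M.
Proof.
move=> cM; have := ss_sum step_c; apply/eqP; rewrite lt_eqF//.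
apply: (@le_lt_trans _ _ M%:E); last exact: ltry.
apply: lime_le.
  by apply: (@is_cvg_nneseries _ _ xpredT) => k _ _; rewrite lee_fin.
apply: nearW => N; rewrite sumEFin lee_fin; apply: le_trans (cM N).
(* The series in [step_size] starts at index 1 and the partial sums here at 0; the extra term is
   nonnegative. *)
case: N => [|N]; first by rewrite big_geq// psum_ge0.
by rewrite -(big_mkord xpredT) [leRHS]big_ltn// lerDr.
Qed.

Lemma step_psum_sqr_bounded : exists M, forall N, \sum_(k < N) c k ^+ 2 <= M.
Proof.
have := ss_sum_sqr step_c; set s := (\sum_(1 <= k <oo) _)%E => s_fin.
have s0 : (0 <= s)%E.
  by apply: nneseries_ge0 => k _ _; rewrite lee_fin sqr_ge0.
exists (c 0%N ^+ 2 + fine s) => N.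
apply: (@le_trans _ _ (\sum_(k < N.+1) c k ^+ 2)).
  by apply: (psum_le (fun k => c k ^+ 2)) => // k; rewrite sqr_ge0.
rewrite -(big_mkord xpredT (fun k => c k ^+ 2)) big_ltn// lerD2l.
rewrite -lee_fin fineK ?ge0_fin_numE// -sumEFin.
by apply: nneseries_lim_ge => k _ _; rewrite lee_fin sqr_ge0.
Qed.

(** If [w] stayed above [e] from [K] on, then [c k] would be at most [c k * w k / e] there and at
    most [c 0] before, which bounds the partial sums of [c]. *)
Lemma step_liminf0 w M : (forall k, 0 <= w k) ->
  (forall N, \sum_(k < N) c k * w k <= M) ->
  forall e K, 0 < e -> exists2 k, (K <= k)%N & w k < e.
Proof.
move=> w0 wM e K e0; apply: contrapT => /forallPNP H.
apply: (@step_psum_unbounded (M / e + K%:R * c 0%N)) => N.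
apply: (@le_trans _ _ (\sum_(k < N) (c k * w k / e + (k < K)%N%:R * c 0%N))).
  apply: ler_sum => k _; have [kK|Kk] := ltnP k K.
    rewrite mul1r -[leLHS]add0r lerD ?(ss_nonincreasing step_c)//.
    by rewrite divr_ge0 ?mulr_ge0// ltW.
  rewrite mul0r addr0 ler_pdivlMr// ler_wpM2l// leNgt.
  by apply/negP; exact: H.
rewrite big_split /=; apply: lerD.
  by rewrite -mulr_suml ler_wpM2r ?invr_ge0 ?(ltW e0)//; exact: wM.
rewrite -mulr_suml ler_wpM2r// -natr_sum ler_nat.
suff : (\sum_(k < N) (k < K)%N = minn N K)%N by move=> ->; exact: geq_minr.
elim: N => [|N IH]; first by rewrite big_ord0 min0n.
by rewrite big_ord_recr /= IH; case: ltnP => NK; lia.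
Qed.

(** A zero step would make all later ones vanish. Then [step_liminf0] applies to the indicator of
    the times from [k] on, which never drops below 1 there. *)
Lemma step_gt0 k : 0 < c k.
Proof.
rewrite lt_neqAle c_ge0 andbT eq_sym; apply/eqP => ck0.
have [l|N|l kl] := @step_liminf0 (fun l => (k <= l)%N%:R) 0 _ _ 1 k ltr01.
- exact: ler0n.
- rewrite big1// => l _; have [kl|] := leqP k l; last by rewrite mulr0.
  rewrite mulr1; apply/eqP; rewrite eq_le c_ge0 andbT -ck0.
  exact: ss_nonincreasing step_c _ _ kl.
- by rewrite kl ltxx.
Qed.

(* Since [c] is non-increasing, [c (k + B)] may be replaced by [c k] in front of
   [D k] and by [c (k + r)] in front of [eps (k + r)]. *)
Lemma delayed_psum_le D eps t B :
  (forall k, 0 <= D k) -> (forall k, 0 <= eps k) ->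
  0 <= t -> t <= 1 ->
  (forall k, D (k + B)%N <= (1 - t) * D k + 2 * \sum_(r < B) eps (k + r)%N) ->
  forall N, t * \sum_(k < N) c k * D k
    <= \sum_(k < B) c k * D k + 2 * B%:R * \sum_(k < N) c k * eps k.
Proof.
move=> D0 eps0 t0 t1 DB N.
pose h k := c k * eps k; pose F k := c k * D k.
have h0 k : 0 <= h k by rewrite mulr_ge0.
have F0 k : 0 <= F k by rewrite mulr_ge0.
have [NB|BN] := leqP N B.
  have := psum_le _ _ _ F0 NB; have := psum_ge0 F N F0.
  have : 0 <= 2 * B%:R * \sum_(k < N) h k by rewrite !mulr_ge0// psum_ge0.
  by rewrite /F /h; nra.
rewrite -(subnKC (ltnW BN)); set N' := (N - B)%N.
have : \sum_(k < B + N') F k <= \sum_(k < B) F k + (1 - t) * \sum_(k < N') F k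
    + 2 * B%:R * \sum_(k < B + N') h k.
  rewrite big_split_ord -addrA lerD2l /=.
  apply: (@le_trans _ _ (\sum_(k < N') ((1 - t) * F k
      + 2 * \sum_(r < B) h (k + r)%N))).
    apply: ler_sum => k _; rewrite addnC.
    apply: (@le_trans _ _ (c (k + B)%N
        * ((1 - t) * D k + 2 * \sum_(r < B) eps (k + r)%N))).
      by rewrite ler_wpM2l.
    rewrite mulrDr; apply: lerD.
      rewrite mulrCA ler_wpM2l ?subr_ge0// ler_wpM2r//.
      by rewrite (ss_nonincreasing step_c)// leq_addr.
    rewrite mulrCA ler_pM2l// mulr_sumr; apply: ler_sum => r _.
    by rewrite ler_wpM2r// (ss_nonincreasing step_c)// leq_add2l ltnW.
  rewrite big_split /= -!mulr_sumr lerD2l -mulrA ler_pM2l// exchange_big /=.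
  rewrite mulr_natl -[X in _ *+ X]card_ord -sumr_const.
  apply: ler_sum => r _.
  apply: (@le_trans _ _ (\sum_(k < r + N') h k)).
    rewrite big_split_ord /= -[leLHS]add0r; apply: lerD; first exact: psum_ge0.
    by apply: ler_sum => k _; rewrite addnC.
  by apply: psum_le => //; rewrite leq_add2r ltnW.
(* Completed to the full range, this sum is absorbed on the left, which leaves the factor [t]. *)
have : (1 - t) * \sum_(k < N') F k <= (1 - t) * \sum_(k < B + N') F k.
  by rewrite ler_wpM2l ?subr_ge0// psum_le// leq_addl.
by rewrite /F /h; lra.
Qed.

Lemma descent_summable S D eps phi t B C : 0 <= C -> 0 < t -> t <= 1 ->
  (forall k, 0 <= S k) -> (forall k, 0 <= D k) -> (forall k, 0 <= eps k) ->
  (forall k, 0 <= phi k) ->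
  (forall k, D (k + B)%N <= (1 - t) * D k + 2 * \sum_(r < B) eps (k + r)%N) ->
  (forall k, S k.+1 + eps k ^+ 2 + 2 * c k * phi k
     <= S k + C * (c k * (D k + eps k))) ->
  exists M, (forall N, \sum_(k < N) c k * (D k + eps k) <= M) /\
            (forall N, \sum_(k < N) c k * phi k <= M).
Proof.
move=> C0 t0 t1 S0 D0 eps0 phi0 DB descent.
have [M2 HM2] := step_psum_sqr_bounded.
have delayed := delayed_psum_le _ _ _ _ D0 eps0 (ltW t0) t1 DB.
pose F N := \sum_(k < N) c k * D k; pose H N := \sum_(k < N) c k * eps k.
pose Q N := \sum_(k < N) eps k ^+ 2; pose P N := \sum_(k < N) c k * phi k.
have F0 N : 0 <= F N by apply: sumr_ge0 => k _; rewrite mulr_ge0.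
have P0 N : 0 <= P N by apply: sumr_ge0 => k _; rewrite mulr_ge0.
have Q0 N : 0 <= Q N by apply: sumr_ge0 => k _; rewrite sqr_ge0.
pose b : R := B%:R; have b0 : 0 <= b by rewrite ler0n.
have FH N : F N <= (F B + 2 * b * H N) / t.
  by rewrite ler_pdivlMr// mulrC; exact: delayed.
have HQ a N : 0 <= a -> a * H N <= Q N / 2 + a ^+ 2 * M2 / 2.
  move=> a0.
  apply: (@le_trans _ _ (Q N / 2 + a ^+ 2 * (\sum_(k < N) c k ^+ 2) / 2)).
    rewrite /H /Q !mulr_sumr !mulr_suml -big_split /=.
    apply: ler_sum => k _; have := sqr_ge0 (eps k - a * c k); nra.
  by rewrite lerD2l ler_pM2r// ler_wpM2l ?sqr_ge0.
have sumd N : S N + Q N + 2 * P N <= S 0%N + C * (F N + H N).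
  rewrite /Q /P /F /H; elim: N => [|N IH]; first by rewrite !big_ord0; lra.
  by rewrite !big_ord_recr /=; have := descent N; lra.
(* The total coefficient of [H N] once [F N] is replaced by its bound [FH]; [HQ] then absorbs
   [a * H N] into half of [Q N]. *)
pose a := C * (2 * b / t + 1).
have a0 : 0 <= a by rewrite mulr_ge0// addr_ge0// divr_ge0 ?mulr_ge0// ltW.
pose K := S 0%N + C * (F B / t) + a ^+ 2 * M2 / 2.
have bound N : Q N / 2 + 2 * P N <= K.
  have := sumd N; have := HQ _ N a0; have := S0 N.
  have : C * F N <= C * ((F B + 2 * b * H N) / t) by rewrite ler_wpM2l.
  have -> : C * ((F B + 2 * b * H N) / t) = C * (F B / t) + a * H N - C * H N.
    by rewrite /a; ring.
  by rewrite /K; lra.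
have K0 : 0 <= K by have := bound 0%N; have := Q0 0%N; have := P0 0%N; lra.
have M20 : 0 <= M2 by have := HM2 0%N; rewrite big_ord0.
have Hb N : H N <= K + M2.
  by have := HQ 1 N ler01; have := bound N; have := P0 N; lra.
have Fb N : F N <= (F B + 2 * b * (K + M2)) / t.
  apply: (le_trans (FH N)); rewrite ler_wpM2r ?invr_ge0 ?(ltW t0)//.
  by rewrite lerD2l ler_wpM2l// mulr_ge0.
exists ((F B + 2 * b * (K + M2)) / t + K + M2); split => N.
  under eq_bigr do rewrite mulrDr.
  by rewrite big_split /=; have := Hb N; have := Fb N; rewrite /H /F; lra.
have := bound N; have := Q0 N; have := Fb 0%N; have := F0 0%N; rewrite /P; lra.
Qed.

End StepSize.

End RealSequences.

(** * The averaging algorithm *)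

Lemma norm_convex_comb_le {R : realType} {n m : nat} (a : 'I_m -> R)
    (F : 'I_m -> 'rV[R]_n) y t :
  (forall j, 0 <= a j) -> \sum_j a j = 1 -> (forall j, `|F j - y| <= t) ->
  `|\sum_j a j *: F j - y| <= t.
Proof.
move=> a0 a1 Ft; rewrite -[y in leLHS]scale1r -a1 scaler_suml -sumrB.
apply: (le_trans (ler_norm_sum _ _ _)).
rewrite -[leRHS]mul1r -a1 mulr_suml; apply: ler_sum => j _.
by rewrite -scalerBr normrZ ger0_norm// ler_wpM2l.
Qed.

Lemma lipschitz_on_bounded_continuous {R : realType} {V : normedModType R}
    (f : V -> R) :
  (forall r, exists2 L, 0 <= L & forall x y, `|x| <= r -> `|y| <= r ->
    f x - f y <= L * `|x - y|) -> continuous f.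
Proof.
move=> lipf x; have [L L0 lipL] := lipf (`|x| + 1).
apply/cvgrPdist_le => e e0; near=> y.
have xy1 : `|x - y| <= 1.
  by near: y; apply: cvgr_dist_le; first exact: cvg_id.
have xye : `|x - y| <= e / (L + 1).
  near: y; apply: cvgr_dist_le; first exact: cvg_id.
  by rewrite divr_gt0//; lra.
have yx1 : `|y| <= `|x| + 1.
  by rewrite -(subKr x y); apply: (le_trans (ler_normB _ _)); rewrite lerD2l.
have h : L * `|x - y| <= e.
  apply: (@le_trans _ _ ((L + 1) * (e / (L + 1)))).
    by apply: ler_pM => //; lra.
  by rewrite mulrC divfK//; lra.
have := lipL x y; have := lipL y x; rewrite (distrC y x) ler_norml.
move=> /(_ yx1 ltac:(lra)) h1 /(_ ltac:(lra) yx1) h2; lra.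
Unshelve. all: by end_near. Qed.

Lemma compact_norm_le {R : realType} {n m : nat} (X : 'I_m -> set 'rV[R]_n) :
  (forall i, compact (X i)) ->
  exists2 r, 0 <= r & forall i x, X i x -> `|x| <= r.
Proof.
move=> cX.
have bX i : exists M : R, forall x, X i x -> `|x| <= M.
  have [M [_ HM]] := compact_bounded (cX i).
  by exists (M + 1) => x Xx; apply: HM => //; rewrite ltrDl.
have [M HM] := choice bX.
exists (\sum_i `|M i|) => [|i x Xx]; first exact: sumr_ge0.
apply: (le_trans (HM _ _ Xx)); apply: (le_trans (ler_norm _)).
by rewrite (bigD1 i)//= lerDl sumr_ge0.
Qed.

Lemma convex_family_lipschitz {R : realType} {n m : nat}
    (f : 'I_m -> 'rV[R]_n -> R) r :
  (forall i, convex_function setT (f i)) ->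
  exists2 L, 0 <= L & forall i x y, `|x| <= r -> `|y| <= r ->
    f i x - f i y <= L * `|x - y|.
Proof.
move=> cf.
have lipf i : exists L : R, 0 <= L /\ forall x y, `|x| <= r -> `|y| <= r ->
    f i x - f i y <= L * `|x - y|.
  by have [L L0 HL] := convex_lipschitz r (cf i); exists L.
have [L HL] := choice lipf.
exists (\sum_i L i) => [|i x y xr yr].
  by apply: sumr_ge0 => i _; case: (HL i).
apply: (le_trans ((HL i).2 _ _ xr yr)); rewrite ler_wpM2r//.
by rewrite (bigD1 i)//= lerDl sumr_ge0// => j _; case: (HL j).
Qed.

Lemma objective_lipschitz {R : realType} {n m : nat}
    {f : 'I_m -> 'rV[R]_n -> R} {r L : R} :
  (forall i x y, `|x| <= r -> `|y| <= r -> f i x - f i y <= L * `|x - y|) ->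
  forall x y, `|x| <= r -> `|y| <= r ->
    objective f x - objective f y <= m%:R * L * `|x - y|.
Proof.
move=> lipf x y xr yr; rewrite /objective -sumrB.
apply: (@le_trans _ _ (\sum_(i < m) L * `|x - y|)).
  by apply: ler_sum => i _; exact: lipf.
by rewrite sumr_const card_ord -mulrA mulr_natl.
Qed.

(** Extreme value theorem. Positivity of [m] provides a compact [X i] that contains the feasible
    set; for [m = 0] that set would be the whole space. *)
Lemma objective_minimizer {R : realType} {n m : nat}
    (f : 'I_m -> 'rV[R]_n -> R) (X : 'I_m -> set 'rV[R]_n) :
  (0 < m)%N -> problem_assumption f X ->
  exists x, is_argmin (feasible X) (objective f) x.
Proof.
move=> m0 HA.
have fc : continuous (objective f).
  apply: lipschitz_on_bounded_continuous => r.
  have [L L0 lipL] := convex_family_lipschitz f r (pa_convex_fun HA).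
  by exists (m%:R * L); [rewrite mulr_ge0|exact: objective_lipschitz].
have feas_compact : compact (feasible X).
  apply: (@subclosed_compact _ _ (X (Ordinal m0))).
  - apply: closed_bigI => i _; apply: compact_closed; first exact: norm_hausdorff.
    exact: pa_compact HA i.
  - exact: pa_compact HA _.
  - by move=> v; apply.
have feas0 : feasible X !=set0.
  by have [v /interior_subset Xv] := pa_interior HA; exists v.
have [v /set_mem Xv vmin] :=
  EVT_min_rV feas0 feas_compact (continuous_subspaceT fc).
by exists v; split => // w /mem_set; exact: vmin.
Qed.

Definition disagreement {R : realType} {n m : nat}
    (x : 'I_m -> nat -> 'rV[R]_n) k : R :=
  \big[Num.max/0]_(p : 'I_m * 'I_m) `|x p.1 k - x p.2 k|.

(** The Euclidean norm of all displacements stacked into one vector: its square is the sum of the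
    terms [dot (p - z) (p - z)] gained from [prox_argmin], and it dominates each displacement. *)
Definition step_error {R : realType} {n m : nat}
    (x z : 'I_m -> nat -> 'rV[R]_n) k : R :=
  Num.sqrt (\sum_i dot (x i k.+1 - z i k) (x i k.+1 - z i k)).

Definition dist_sum {R : realType} {n m : nat}
    (x : 'I_m -> nat -> 'rV[R]_n) v k : R :=
  \sum_i dot (x i k - v) (x i k - v).

Section Averaging.
Context {R : realType} {n m : nat}.
Context {f : 'I_m -> 'rV[R]_n -> R} {X : 'I_m -> set 'rV[R]_n}.
Context {E : nat -> rel 'I_m} {A : nat -> 'M[R]_m} {c : nat -> R}.
Context {x z g d : 'I_m -> nat -> 'rV[R]_n}.
Hypotheses (HA1 : problem_assumption f X) (Hnet : network E A).
Hypotheses (HA2 : network_assumption E A) (Hc : step_size c).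
Hypothesis (Halg : subgradient_averaging f X A c x z g d).

Let a_ge0 k j i : 0 <= A k j i.
Proof. by have [] := na_stochastic HA2 k. Qed.

Let a_row k j : \sum_i A k j i = 1.
Proof. by have [] := na_stochastic HA2 k. Qed.

Let a_col k i : \sum_j A k j i = 1.
Proof. by have [] := na_stochastic HA2 k. Qed.

Lemma iterate_mem i k : X i (x i k).
Proof.
by case: k => [|k]; [exact: sa_init Halg i|have [] := sa_update Halg i k].
Qed.

Lemma disagreement_ge0 k : 0 <= disagreement x k.
Proof. by apply/bigmax_geP; left. Qed.

Lemma norm_iterateB_le i j k : `|x i k - x j k| <= disagreement x k.
Proof. by apply/bigmax_geP; right; exists (i, j). Qed.

Lemma norm_averageB_le i j k : `|z j k - x i k| <= disagreement x k.
Proof.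
rewrite (sa_average Halg); apply: norm_convex_comb_le => // l.
exact: norm_iterateB_le.
Qed.

Lemma step_error_ge0 k : 0 <= step_error x z k.
Proof. exact: sqrtr_ge0. Qed.

Lemma step_error_sqr k :
  step_error x z k ^+ 2 = \sum_i dot (x i k.+1 - z i k) (x i k.+1 - z i k).
Proof. by rewrite sqr_sqrtr// sumr_ge0// => i _; exact: dot_ge0. Qed.

Lemma norm_step_error_le i k : `|x i k.+1 - z i k| <= step_error x z k.
Proof.
rewrite -ler_sqr ?nnegrE ?step_error_ge0// step_error_sqr.
apply: (le_trans (sqr_norm_le_dot _)).
by rewrite (bigD1 i)//= lerDl sumr_ge0// => j _; exact: dot_ge0.
Qed.

(** The sup norm lets [diameter_contraction] act on each coordinate separately, with constants
    common to all coordinates. *)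
Lemma disagreement_contraction : exists t B, [/\ 0 < t, t <= 1 &
  forall k, disagreement x (k + B)
    <= (1 - t) * disagreement x k + 2 * \sum_(r < B) step_error x z (k + r)%N].
Proof.
have [t [B [t0 t1 H]]] := diameter_contraction E A Hnet HA2.
exists t, B; split => // k; apply/bigmax_leP.
have rhs0 : 0 <= (1 - t) * disagreement x k
    + 2 * \sum_(r < B) step_error x z (k + r)%N.
  rewrite addr_ge0// mulr_ge0 ?subr_ge0 ?disagreement_ge0//.
  by apply: sumr_ge0 => r _; exact: step_error_ge0.
split => // -[i j] _ /=; apply: norm_row_le => // l.
pose a k i := x i k ord0 l; pose e k i := (x i k.+1 - z i k) ord0 l.
have aS k' i' : a k'.+1 i' = \sum_j A k' j i' * a k' j + e k' i'.
  have -> : \sum_j A k' j i' * a k' j = z i' k' ord0 l.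
    by rewrite (sa_average Halg) summxE; apply: eq_bigr => j' _; rewrite mxE.
  by rewrite /e /a !mxE; ring.
have eS k' i' : `|e k' i'| <= step_error x z k'.
  exact: le_trans (norm_entry_le _ _) (norm_step_error_le _ _).
have aD i' j' : a k i' - a k j' <= disagreement x k.
  apply: (le_trans (ler_norm _)); apply: le_trans (norm_iterateB_le i' j' k).
  by have := norm_entry_le (x i' k - x j' k) l; rewrite !mxE.
have := H a e (step_error x z) aS eS k _ aD i j.
have := H a e (step_error x z) aS eS k _ aD j i.
by rewrite !mxE ler_norml /a; lra.
Qed.

(** * One-step descent of the summed squared distances to a feasible point *)

Section Descent.
Variables (r L : R).
Hypotheses (L0 : 0 <= L) (normX : forall i v, X i v -> `|v| <= r).
Hypothesis lipf : forall i v w, `|v| <= r + 1 -> `|w| <= r + 1 ->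
  f i v - f i w <= L * `|v - w|.

Let norm_z j k : `|z j k| <= r.
Proof.
rewrite -[z j k]subr0 (sa_average Halg); apply: norm_convex_comb_le => // l.
by rewrite subr0; exact/normX/iterate_mem.
Qed.

Let norm_g j k : `|g j k| <= L.
Proof.
apply: (subgradient_norm_le _ _ _ _ L0 (lipf j) (norm_z j k)).
exact: sa_subgradient Halg j k.
Qed.

Let norm_d i k : `|d i k| <= L.
Proof.
rewrite -[d i k]subr0 (sa_direction Halg); apply: norm_convex_comb_le => // j.
by rewrite subr0.
Qed.

Let dot_le (u v : 'rV[R]_n) t : `|u| <= L -> `|v| <= t ->
  dot u v <= n%:R * L * t.
Proof.
move=> uL vt; apply: (le_trans (ler_norm _)).
apply: (le_trans (dot_norm_le _ _)).
by rewrite -mulrA ler_wpM2l// ler_pM.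
Qed.

(** Split [v - x i k.+1] at [y] and [z i k]. On [v - y], unit row sums replace the directions by the
    subgradients, which are then used at [z j k]. Per agent, [D] has coefficient [(2 * n + 1) * L]:
    two scalar products, each costing [n * L] in the sup norm, and one Lipschitz estimate. *)
Let direction_le i0 v k :
  \sum_i dot (d i k) (v - x i k.+1)
  <= objective f v - objective f (x i0 k)
     + m%:R * (2 * n%:R + 1) * L * (disagreement x k + step_error x z k).
Proof.
set y := x i0 k; set D := disagreement x k; set e := step_error x z k.
have sum_d : \sum_i dot (d i k) (v - y) = \sum_j dot (g j k) (v - y).
  under eq_bigr do rewrite (sa_direction Halg) dot_suml.
  rewrite exchange_big /=; apply: eq_bigr => j _.
  by under eq_bigr do rewrite dotZl; rewrite -mulr_suml a_row mul1r.
have -> : \sum_i dot (d i k) (v - x i k.+1) = \sum_j (dot (g j k) (v - y)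
    + dot (d j k) (y - z j k) + dot (d j k) (z j k - x j k.+1)).
  rewrite !big_split /= -sum_d -!big_split /=; apply: eq_bigr => i _.
  by rewrite !dotBr; ring.
rewrite /objective -sumrB -mulrA -mulrA mulr_natl -[X in _ *+ X]card_ord.
rewrite -sumr_const -big_split /=; apply: ler_sum => j _.
have D0 : 0 <= D := disagreement_ge0 k.
have e0 : 0 <= e := step_error_ge0 k.
have zy : `|z j k - y| <= D := norm_averageB_le i0 j k.
have yz : `|y - z j k| <= D by rewrite distrC.
have ze : `|z j k - x j k.+1| <= e by rewrite distrC; exact: norm_step_error_le.
have h1 := dot_le _ _ _ (norm_d j k) yz.
have h2 := dot_le _ _ _ (norm_d j k) ze.
have h3 := dot_le _ _ _ (norm_g j k) zy.
have h4 : f j y - f j (z j k) <= L * D.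
  apply: (@le_trans _ _ (L * `|y - z j k|)); last by rewrite ler_wpM2l.
  have yr : `|y| <= r := normX _ _ (iterate_mem i0 k).
  by apply: lipf; [|have := norm_z j k]; lra.
have h5 := sa_subgradient Halg j k v.
have nL : 0 <= n%:R * L by rewrite mulr_ge0.
have : dot (g j k) (v - y) = dot (g j k) (v - z j k) + dot (g j k) (z j k - y).
  by rewrite !dotBr; ring.
have : 0 <= n%:R * L * e by rewrite mulr_ge0.
have : 0 <= L * e by rewrite mulr_ge0.
lra.
Qed.

(** Double stochasticity enters twice: column sums for Jensen at each [z i k], row sums after the
    exchange of the two summations. *)
Lemma dist_sum_step i0 v k : feasible X v ->
  dist_sum x v k.+1 + step_error x z k ^+ 2
  <= dist_sum x v k + 2 * c k * (objective f v - objective f (x i0 k)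
     + m%:R * (2 * n%:R + 1) * L * (disagreement x k + step_error x z k)).
Proof.
move=> Xv; have ck := step_gt0 _ Hc k.
apply: (@le_trans _ _ (\sum_i (dot (z i k - v) (z i k - v)
    + 2 * c k * dot (d i k) (v - x i k.+1)))).
  rewrite step_error_sqr -big_split /=; apply: ler_sum => i _.
  apply: (prox_argmin _ _ _ _ _ _ _ ck (sa_update Halg i k)).
    exact: pa_convex_set HA1 i.
  exact: Xv.
rewrite big_split /= -mulr_sumr; apply: lerD; last first.
  by rewrite ler_wpM2l// ?direction_le// mulr_ge0// ltW.
apply: (@le_trans _ _ (\sum_i \sum_j A k j i * dot (x j k - v) (x j k - v))).
  apply: ler_sum => i _; rewrite (sa_average Halg).
  have -> : \sum_j A k j i *: x j k - v = \sum_j A k j i *: (x j k - v).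
    under [RHS]eq_bigr do rewrite scalerBr.
    by rewrite sumrB -scaler_suml a_col scale1r.
  exact: dot_convex_comb.
rewrite exchange_big /=; apply: ler_sum => j _.
by rewrite -mulr_suml a_row mul1r.
Qed.

End Descent.
End Averaging.

(** * Convergence *)

Lemma compact_limit_point {R : realType} {V : normedModType R} (S : set V)
    (u : nat -> V) :
  compact S -> (forall k, S (u k)) ->
  exists p, forall e K, 0 < e -> exists2 k, (K <= k)%N & `|u k - p| <= e.
Proof.
move=> cS Su.
have [|p [_ clp]] := cS (u @ \oo).
  by exists 0%N => // k _; exact: Su.
exists p => e K e0.
have [_ [[k Kk <-]]] := clp [set u k | k in [set k | (K <= k)%N]] (ball p e)
  (ltac:(by exists K => // k Kk; exists k)) (nbhsx_ballx p e e0).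
by rewrite -ball_normE /ball_ /= => /ltW; rewrite distrC; exists k.
Qed.

Lemma dist_sum_le {R : realType} {n m : nat} (x : 'I_m -> nat -> 'rV[R]_n)
    v k t : 0 <= t -> (forall i, `|x i k - v| <= t) ->
  dist_sum x v k <= m%:R * n%:R * t ^+ 2.
Proof.
move=> t0 xt; rewrite -mulrA mulr_natl -[X in _ *+ X]card_ord -sumr_const.
apply: ler_sum => i _; apply: (le_trans (ler_norm _)).
apply: (le_trans (dot_norm_le _ _)); rewrite expr2 ler_wpM2l//.
by apply: ler_pM.
Qed.

Lemma norm2_cvg0 {R : realType} {n m : nat} (x : 'I_m -> nat -> 'rV[R]_n) v :
  (forall e, 0 < e -> exists K, forall k, (K <= k)%N -> dist_sum x v k <= e) ->
  forall i, norm2 (x i k - v) @[k --> \oo] --> (0 : R).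
Proof.
move=> Sv i; apply/cvgrPdist_le => e e0.
have [K HK] := Sv (e ^+ 2) (exprn_gt0 2 e0).
exists K => // k /= Kk; rewrite sub0r normrN ger0_norm ?norm2_ge0//.
rewrite -ler_sqr ?nnegrE ?norm2_ge0 ?(ltW e0)// norm2_sqr.
apply: le_trans (HK k Kk); rewrite /dist_sum (bigD1 i)//= lerDl sumr_ge0//.
by move=> j _; exact: dot_ge0.
Qed.

Theorem theorem1 (R : realType) (n m : nat)
    (f : 'I_m -> 'rV[R]_n -> R) (X : 'I_m -> set 'rV[R]_n)
    (E : nat -> rel 'I_m) (A : nat -> 'M[R]_m) (c : nat -> R)
    (x z g d : 'I_m -> nat -> 'rV[R]_n)
    (HA1 : problem_assumption f X)
    (Hnet : network E A)
    (HA2 : network_assumption E A)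
    (Hc : step_size c)
    (Halg : subgradient_averaging f X A c x z g d) :
  exists xstar : 'rV[R]_n,
    is_argmin (feasible X) (objective f) xstar /\
    forall i : 'I_m, norm2 (x i k - xstar) @[k --> \oo] --> (0 : R).
Proof.
(* The attained maximum comes with a point of some [X i0], so there is at least one agent. *)
have [_ [[_ [w [i0 _ _] _] _] _]] := pa_subgradients HA1.
have m0 : (0 < m)%N by exact: leq_ltn_trans (ltn_ord i0).
have [xs [Xxs xs_min]] := objective_minimizer f X m0 HA1.
have [r r0 normX] := compact_norm_le X (pa_compact HA1).
have [L L0 lipf] := convex_family_lipschitz f (r + 1) (pa_convex_fun HA1).
have [t [B [t0 t1 contr]]] := disagreement_contraction Hnet HA2 Halg.
have [K K0 reg] := linear_regularity X r (pa_convex_set HA1) (pa_interior HA1).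
have descent := dist_sum_step HA1 HA2 Hc Halg r L L0 normX lipf i0.
have xX := iterate_mem Halg.
have cX : forall i, compact (X i) := pa_compact HA1.
pose y k := x i0 k; pose D := disagreement x; pose eps := step_error x z.
have D0 k : 0 <= D k := disagreement_ge0 k.
have eps0 k : 0 <= eps k := step_error_ge0 k.
have yr k : `|y k| <= r := normX _ _ (xX i0 k).
have mL0 : 0 <= m%:R * L by rewrite mulr_ge0.
have lip v w' : `|v| <= r -> `|w'| <= r ->
    objective f v - objective f w' <= m%:R * L * `|v - w'|.
  by move=> vr wr; apply: (objective_lipschitz lipf); lra.
(* Moving [y k] to a feasible point at distance at most [K * D k] changes the objective by at most
   [C2 * D k]. *)
pose C2 := m%:R * L * K; have C20 : 0 <= C2 by rewrite mulr_ge0.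
pose phi k := objective f (y k) - objective f xs + C2 * D k.
have phi0 k : 0 <= phi k.
  have [v Xv yv] : exists2 v, feasible X v & `|y k - v| <= K * D k.
    apply: reg => // i; exists (x i k); first exact: xX.
    exact: norm_iterateB_le.
  have vr : `|v| <= r by apply: (normX i0); exact: Xv.
  have := xs_min v Xv; have := lip v (y k) vr (yr k); rewrite distrC.
  have : m%:R * L * `|y k - v| <= C2 * D k by rewrite /C2 -(mulrA _ K) ler_wpM2l.
  by rewrite /phi; lra.
pose C1 := m%:R * (2 * n%:R + 1) * L.
have C10 : 0 <= C1 by rewrite !mulr_ge0// addr_ge0// mulr_ge0.
pose C := 2 * (C1 + C2); have C0 : 0 <= C by rewrite mulr_ge0// addr_ge0.
have c0 := ss_ge0 Hc.
(* Kept general in [v]: it serves for [xs] to obtain summability, and later for the limit point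
   [p]. *)
have descent_phi v k : feasible X v -> objective f v = objective f xs ->
    dist_sum x v k.+1 + eps k ^+ 2 + 2 * c k * phi k
    <= dist_sum x v k + C * (c k * (D k + eps k)).
  move=> Xv fv; have := descent v k Xv; rewrite fv -/(y k) -/(D k) -/(eps k) -/C1.
  have : 0 <= C2 * c k * eps k by rewrite !mulr_ge0.
  by rewrite /phi /C; lra.
have S0 v k : 0 <= dist_sum x v k by apply: sumr_ge0 => i _; exact: dot_ge0.
have [M [sumDe sumphi]] := descent_summable c Hc (dist_sum x xs) D eps phi t B C
  C0 t0 t1 (S0 xs) D0 eps0 phi0 contr (fun k => descent_phi xs k Xxs erefl).
have De0 k : 0 <= D k + eps k by rewrite addr_ge0.
(* A single quantity, so that all three terms are small at the same times. *)
pose gap k := D k + eps k + phi k.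
have gap_small (j : nat) : exists k, (j <= k)%N /\ gap k < j.+1%:R^-1.
  have [|N||k] := step_liminf0 c Hc gap (M + M) _ _ j.+1%:R^-1 j.
  - by move=> k; rewrite addr_ge0.
  - under eq_bigr do rewrite mulrDr.
    by rewrite big_split /=; exact: lerD (sumDe N) (sumphi N).
  - by rewrite invr_gt0.
  - by exists k.
have [kappa Hkappa] := choice gap_small.
have [p Hp] := compact_limit_point (X i0) (y \o kappa) (cX i0)
  (fun j => xX i0 (kappa j)).
have near_p e k0 : 0 < e ->
    exists2 k, (k0 <= k)%N & `|y k - p| <= e /\ gap k <= e.
  move=> e0; have [N HN] : exists N : nat, N.+1%:R^-1 <= e.
    exists (Num.truncn e^-1); rewrite -[leRHS]invrK lef_pV2 ?posrE ?invr_gt0//.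
    by apply/ltW/truncnS_gt.
  have [j jN yp] := Hp e (maxn k0 N) e0.
  have [jk gapj] := Hkappa j; exists (kappa j).
    by apply: leq_trans jk; apply: leq_trans jN; exact: leq_maxl.
  split => //; apply: (le_trans (ltW gapj)); apply: le_trans HN.
  by rewrite lef_pV2 ?posrE// ler_nat ltnS (leq_trans _ jN)// leq_maxr.
have all_near_p e k : `|y k - p| <= e -> gap k <= e ->
    forall i, `|x i k - p| <= 2 * e.
  move=> yp ge i; rewrite -(subrKA (y k)).
  apply: (le_trans (ler_normD _ _)).
  have := norm_iterateB_le i i0 k (x := x); have := phi0 k; have := eps0 k.
  by move: ge; rewrite /gap -/(D k); lra.
have Xp : feasible X p.
  move=> i _; apply: (compact_closed _ (cX i)).
    exact: norm_hausdorff.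
  move=> U /nbhs_ballP[e e0 ballU]; have e0' : 0 < e := e0.
  have e3 : 0 < e / 3 by lra.
  have [k _ [yp gk]] := near_p (e / 3) 0%N e3.
  exists (x i k); split; first exact: xX.
  apply: ballU; rewrite -ball_normE /ball_ /= distrC.
  by have := all_near_p _ _ yp gk i; lra.
have pr : `|p| <= r := normX _ _ (Xp i0 I).
have fp : objective f p = objective f xs.
  apply/eqP; rewrite eq_le xs_min// andbT; apply/ler_addgt0Pl => e e0.
  (* At tolerance [e / a], passing from [p] to [y k] costs [m * L] tolerances and the optimality gap
     of [y k] at most one more. *)
  pose a := m%:R * L + 1; have a0 : 0 < a by rewrite /a; lra.
  have [k _ [yp gk]] := near_p (e / a) 0%N (divr_gt0 e0 a0).
  have : a * (e / a) = e by rewrite mulrC divfK// gt_eqF.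
  have := lip p (y k) pr (yr k); rewrite distrC.
  have : m%:R * L * `|y k - p| <= m%:R * L * (e / a) by rewrite ler_wpM2l.
  have := De0 k; have := mulr_ge0 C20 (D0 k).
  by move: gk; rewrite /gap /phi /a; lra.
exists p; split; first by split => // v Xv; rewrite fp; exact: xs_min.
apply: norm2_cvg0.
apply: (quasi_fejer_cvg0 (dist_sum x p)
  (fun k => C * (c k * (D k + eps k))) (C * M)).
- by move=> k; exact: mulr_ge0 C0 (mulr_ge0 (c0 k) (De0 k)).
- by move=> N; rewrite -mulr_sumr; exact: ler_wpM2l C0 _ _ (sumDe N).
- move=> k; have := descent_phi p k Xp fp; have := sqr_ge0 (eps k).
  have : 0 <= 2 * c k * phi k by rewrite !mulr_ge0.
  by rewrite -/(eps k); lra.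
move=> e k0 e0; pose b : R := 4 * (m%:R * n%:R) + 1.
have mn0 : 0 <= m%:R * n%:R :> R by rewrite mulr_ge0.
have b0 : 0 < b by rewrite /b; lra.
(* The bound [m * n * (2 * e') ^+ 2] is at most [b * e'] because [e'] is at most 1, hence at most
   [e]. *)
pose e' := Num.min 1 (e / b).
have e'0 : 0 < e' by rewrite lt_min ltr01 divr_gt0.
have [k k0k [yp gk]] := near_p e' k0 e'0; exists k => //.
apply: (le_trans (dist_sum_le x p k (2 * e') _ (all_near_p _ _ yp gk))).
  lra.
have e'1 : e' <= 1 by rewrite ge_min lexx.
have e'e : e' <= e / b by rewrite ge_min lexx orbT.
have : b * e' <= e by rewrite mulrC -ler_pdivlMr.
have : m%:R * n%:R * e' ^+ 2 <= m%:R * n%:R * e'.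
  by rewrite ler_wpM2l// expr2 ler_piMl// ltW.
by rewrite /b exprMn; lra.
Qed.
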